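(* In the setting described in the context, suppose that for every $0\le k\le S-1$ and $s\in I_k$, $$m_{0,k}\le C(S-k+s),\qquad m_{1,k}\ge2(S-k+s)A_1,$$ and that there exist $\Delta>0$ and $0<\tilde M<M$ such that for every $0\le j\le S-1$ $$|W_j(\epsilon,\tau)|\le\Delta e^{\tilde M\log^2|\tau/\epsilon|},\qquad\tau\in Vq^{\mathbb R_+},\ \epsilon\in Uq^{-\mathbb N}.$$ Then there exists $W(\epsilon,\tau,z)=\sum_{\beta\ge0}W_\beta(\epsilon,\tau)\frac{z^\beta}{\beta!}\in\mathcal O(Uq^{-\mathbb N}\times Vq^{\mathbb R_+})[[z]]$ solving $$\partial_z^SW(\epsilon,\tau,z)=\sum_{k=0}^{S-1}\frac{b_k(\epsilon,z)}{(\tau+1)\epsilon^{m_{0,k}}}\tau^{m_{0,k}}(\partial_z^kW)(\epsilon,\tau,zq^{-m_{1,k}})$$ with initial conditions $(\partial_z^jW)(\epsilon,\tau,0)=W_j(\epsilon,\tau)$, $0\le j\le S-1$, and there exist $C_2>0$ and $0<\delta<1$ such that $$|W_\beta(\epsilon,\tau)|\le C_2\,\beta!\left(\frac{|q|^{2A_1S}}{\delta}\right)^{\beta}\left|\frac\tau\epsilon\right|^{C\beta}e^{M\log^2|\tau/\epsilon|}|q|^{-A_1\beta^2},\qquad\beta\ge0,$$ for every $\epsilon\in Uq^{-\mathbb N}$ and $\tau\in Vq^{\mathbb R_+}$.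
   Context: $M,A_1,C>0$ are fixed real numbers; $q\in\mathbb C$ with $|q|>1$; a determination of $\log q$ is fixed and $q^l=e^{l\log q}$. $U,V$ are bounded open sets in $\mathbb C^\star=\mathbb C\setminus\{0\}$, $Uq^{-\mathbb N}=\{\epsilon q^{-n}:\epsilon\in U,n\in\mathbb N\}$, $Vq^{\mathbb R_+}=\{\tau q^l:\tau\in V,l\ge0\}$, $\mathbb N=\{0,1,\dots\}$. There exists $M_1>0$ with $|\tau+1|>M_1$ for all $\tau\in Vq^{\mathbb R_+}$, and the distance from $V$ to the origin is positive. $S\ge1$ is an integer; for $0\le k\le S-1$, $m_{0,k},m_{1,k}$ are positive integers and $b_k(\epsilon,z)=\sum_{s\in I_k}b_{ks}(\epsilon)z^s$ where $I_k\subset\mathbb N$ is finite and $b_{ks}$ are bounded holomorphic functions on $D(0,r_0)$, with $\overline{Uq^{-\mathbb N}}\subseteq D(0,r_0)$. The functions $W_j$, $0\le j\le S-1$, belong to $\mathcal O(Uq^{-\mathbb N}\times Vq^{\mathbb R_+})$. $\mathcal O(\Omega)$ denotes holomorphic functions on $\Omega$ and $\mathcal O(\Omega)[[z]]$ formal power series in $z$ with such coefficients. *)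

(* Defs.v *)
From Stdlib Require Import Reals List Arith.
From Coquelicot Require Export Coquelicot.
Open Scope R_scope.

(** Holomorphy on an open set [D] is complex Fréchet differentiability at
    every point of [D]: the differential is linear over [C_AbsRing].  It is
    used with [E = C] and with [E = C * C]. *)
Definition holomorphic_on {E : NormedModule C_AbsRing}
    (D : E -> Prop) (f : E -> C) : Prop :=
  forall x : E, D x -> ex_filterdiff (V := C_NormedModule) f (locally x).

Definition C2 : NormedModule C_AbsRing :=
  prod_NormedModule C_AbsRing C_NormedModule C_NormedModule.

Definition Cbounded (A : C -> Prop) : Prop :=
  exists B : R, forall x : C, A x -> Cmod x <= B.

Definition Cclosure (A : C -> Prop) (x : C) : Prop :=
  forall e : R, 0 < e -> exists y : C, A y /\ Cmod (y - x)%C < e.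

Definition Cdisc (r : R) (x : C) : Prop := Cmod x < r.

Definition Cexp (z : C) : C := (exp (Re z) * cos (Im z), exp (Re z) * sin (Im z)).

(** [q^l] for real [l], where [logq] is the chosen determination of [log q]. *)
Definition qpow (logq : C) (l : R) : C := Cexp (RtoC l * logq)%C.

Definition discrete_spiral (q : C) (U : C -> Prop) (x : C) : Prop :=
  exists (e : C) (n : nat), U e /\ x = (e / q ^ n)%C.

Definition continuous_spiral (logq : C) (V : C -> Prop) (x : C) : Prop :=
  exists (t : C) (l : R), V t /\ 0 <= l /\ x = (t * qpow logq l)%C.

Definition Cprod (A B : C -> Prop) (p : C2) : Prop := A (fst p) /\ B (snd p).

(** A formal power series in [z], given by the coefficients of the [z^n].  A
    series with coefficients in a ring of functions on a set is handled through
    its specialization at each point of that set. *)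
Definition fps : Type := nat -> C.

(** The series [sum_n w_n z^n / n!]. *)
Definition fps_egf (w : nat -> C) : fps :=
  fun n => (w n / RtoC (INR (fact n)))%C.

Definition fps_deriv (a : fps) : fps :=
  fun n => (RtoC (INR (n + 1)) * a (n + 1)%nat)%C.

Definition fps_derivn (k : nat) (a : fps) : fps := Nat.iter k fps_deriv a.

Definition fps_scal (c : C) (a : fps) : fps := fun n => (c * a n)%C.

Definition fps_mul (a b : fps) : fps :=
  fun n => sum_n (fun i => (a i * b (n - i)%nat)%C) n.

(** The series [a (c z)]. *)
Definition fps_dilate (c : C) (a : fps) : fps := fun n => (c ^ n * a n)%C.

Definition fps_eval0 (a : fps) : C := a 0%nat.

(** The polynomial [sum_(s in J) c_s z^s]; the list [J] stands for the finite
    set of its members, so repetitions are irrelevant. *)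
Definition fps_poly (J : list nat) (c : nat -> C) : fps :=
  fun n => if in_dec Nat.eq_dec n J then c n else RtoC 0.

(* Main.v *)
(** Comparing coefficients of [z^n], the equation expresses [W_(n+S)] through the
    [W_(n-i+k)] with [k < S] and [i] in [I_k], so a course-of-values recursion
    produces the unique solution and holomorphy is inherited term by term.

    For the estimate put [x = |tau/eps|], [Q = |q|], [rho = Q^(2 A1 S) / delta].  By
    induction, [|W_n| <= K e^(M log^2 x) n! rho^n x^(C n) Q^(- A1 n^2)]: with
    [h = S - k + i] the dilation contributes at most [Q^(- 2 h A1 (n - i))], which
    turns [Q^(- A1 (n + S - h)^2)] into [Q^(- A1 (n + S)^2)] up to a bounded factor,
    and [x^m0] is at most a constant times [x^(C h)] because [x] is bounded away from
    0.  The remaining constants are absorbed by the factor [rho^(-h) <= 1 / rho],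
    which is small for small [delta]. *)

Require Import Defs.
From Stdlib Require Import Reals List Arith Lia Lra.
From Coquelicot Require Import Coquelicot.
Open Scope R_scope.

(** * Rules of complex differentiation for maps into [C] *)

Definition Cdiff_at {E : NormedModule C_AbsRing} (f : E -> C) (x : E) : Prop :=
  ex_filterdiff (V := C_NormedModule) f (locally x).

(* [C] carries two uniform structures, with square balls and with round balls;
   differentials into [C] only see the norm, which is the same. *)
Lemma filterdiff_C_AbsRing {E : NormedModule C_AbsRing} (f l : E -> C) (F : (E -> Prop) -> Prop) :
  filterdiff (V := C_NormedModule) f F l <->
  filterdiff (V := AbsRing_NormedModule C_AbsRing) f F l.
Proof. split; intros [[H1 H2 H3] H4]; (split; [split|]; assumption). Qed.

Lemma Cdiff_at_mult {E : NormedModule C_AbsRing} (f g : E -> C) (x : E) :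
  Cdiff_at f x -> Cdiff_at g x -> Cdiff_at (fun y => f y * g y)%C x.
Proof.
  (* The product rule concerns maps into the ring itself, so both differentials are carried to that
     structure and the result is carried back. *)
  intros [lf Hf%filterdiff_C_AbsRing] [lg Hg%filterdiff_C_AbsRing].
  eexists. apply filterdiff_C_AbsRing.
  exact (filterdiff_mult_fct (K := C_AbsRing) f g x lf lg Cmult_comm Hf Hg).
Qed.

Lemma Cdiff_at_const {E : NormedModule C_AbsRing} (c : C) (x : E) :
  Cdiff_at (fun _ => c) x.
Proof. apply (ex_filterdiff_const (V := C_NormedModule)). Qed.

Lemma Cdiff_at_plus {E : NormedModule C_AbsRing} (f g : E -> C) (x : E) :
  Cdiff_at f x -> Cdiff_at g x -> Cdiff_at (fun y => f y + g y)%C x.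
Proof.
  intros Hf Hg. exact (ex_filterdiff_plus_fct (V := C_NormedModule) f g Hf Hg).
Qed.

Lemma Cdiff_at_ext {E : NormedModule C_AbsRing} (f g : E -> C) (x : E) :
  (forall y, f y = g y) -> Cdiff_at f x -> Cdiff_at g x.
Proof. intros H Hf. exact (ex_filterdiff_ext (V := C_NormedModule) f g H Hf). Qed.

Lemma Cdiff_at_pow {E : NormedModule C_AbsRing} (f : E -> C) (x : E) (n : nat) :
  Cdiff_at f x -> Cdiff_at (fun y => f y ^ n)%C x.
Proof.
  intros Hf; induction n as [|n IH].
  - exact (Cdiff_at_const (RtoC 1) x).
  - exact (Cdiff_at_mult _ _ x Hf IH).
Qed.

Lemma Cdiff_at_sum_n {E : NormedModule C_AbsRing} (f : nat -> E -> C) (x : E) (n : nat) :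
  (forall i, (i <= n)%nat -> Cdiff_at (f i) x) ->
  Cdiff_at (fun y => sum_n (fun i => f i y) n) x.
Proof.
  induction n as [|n IH]; intros Hf.
  - apply Cdiff_at_ext with (f 0%nat).
    + intros y; now rewrite sum_O.
    + now apply Hf.
  - apply Cdiff_at_ext with (fun y => sum_n (fun i => f i y) n + f (S n) y)%C.
    + intros y; now rewrite sum_Sn.
    + apply Cdiff_at_plus; [apply IH; intros i Hi|]; apply Hf; lia.
Qed.

(** The remainder is exact: [/ y - / x + (y - x) / x^2 = (y - x)^2 / (x^2 y)], which is quadratic in
    [y - x] as long as [y] stays away from 0. *)
Lemma filterdiff_Cinv (x : C) : x <> RtoC 0 ->
  filterdiff (U := C_NormedModule) (V := C_NormedModule) Cinv
    (locally (T := C_NormedModule) x) (fun h => - h / (x * x))%C.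
Proof.
  intros Hx.
  assert (H0 : 0 < Cmod x) by now apply Cmod_gt_0.
  split.
  - split.
    + intros u v; change (- (u + v) / (x * x) = - u / (x * x) + - v / (x * x))%C.
      field; exact Hx.
    + intros k u; change (- (k * u) / (x * x) = k * (- u / (x * x)))%C.
      field; exact Hx.
    + exists (/ (Cmod x * Cmod x)). split.
      * apply Rinv_0_lt_compat; nra.
      * intros u. change (Cmod (- u / (x * x)) <= / (Cmod x * Cmod x) * Cmod u).
        rewrite Cmod_div by now apply Cmult_neq_0.
        rewrite Cmod_opp, Cmod_mult. right; field. lra.
  - intros x' Hx'.
    apply is_filter_lim_locally_unique in Hx'. subst x'.
    intros eps.
    (* The first entry forces [|y| >= |x| / 2]; given this, the second forces
       [|y - x| <= eps |x|^2 |y|]. *)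
    set (d := Rmin (Cmod x / 2) (eps * (Cmod x ^ 3 / 2))).
    assert (Hd : 0 < d).
    { apply Rmin_pos; [lra|].
      apply Rmult_lt_0_compat; [apply cond_pos|]. pose proof (pow_lt _ 3 H0). lra. }
    generalize (locally_le_locally_norm x _ (locally_norm_ball_norm x (mkposreal d Hd))).
    apply filter_imp. intros y Hy.
    change (Cmod (y - x) < d) in Hy.
    change (Cmod (/ y - / x - - (y - x) / (x * x)) <= eps * Cmod (y - x)).
    assert (Hy1 : Cmod (y - x) < Cmod x / 2) by (eapply Rlt_le_trans; [exact Hy|apply Rmin_l]).
    assert (Hy2 : Cmod (y - x) < eps * (Cmod x ^ 3 / 2)) by (eapply Rlt_le_trans; [exact Hy|apply Rmin_r]).
    assert (Hxy : Cmod x / 2 <= Cmod y).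
    { pose proof (Cmod_triangle y (- (y - x))) as H.
      replace (y + - (y - x))%C with x in H by ring.
      rewrite Cmod_opp in H. lra. }
    assert (Hy0 : y <> RtoC 0) by (apply Cmod_gt_0; lra).
    replace (/ y - / x - - (y - x) / (x * x))%C
      with ((y - x) * ((y - x) / (x * x * y)))%C by (field; now split).
    rewrite Cmod_mult, Rmult_comm.
    apply Rmult_le_compat_r; [apply Cmod_ge_0|].
    rewrite Cmod_div by (repeat apply Cmult_neq_0; assumption).
    rewrite !Cmod_mult.
    assert (0 < Cmod x * Cmod x) by nra.
    apply Rle_div_l; [nra|].
    apply Rlt_le, (Rlt_le_trans _ _ _ Hy2).
    apply Rmult_le_compat_l; [left; apply cond_pos|].
    replace (Cmod x ^ 3 / 2) with (Cmod x * Cmod x * (Cmod x / 2)) by field.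
    apply Rmult_le_compat_l; lra.
Qed.

Lemma Cdiff_at_div {E : NormedModule C_AbsRing} (f g : E -> C) (x : E) :
  g x <> RtoC 0 ->
  Cdiff_at f x -> Cdiff_at g x -> Cdiff_at (fun y => f y / g y)%C x.
Proof.
  intros Hx Hf Hg. apply Cdiff_at_mult; [exact Hf|].
  apply (ex_filterdiff_comp' (V := C_NormedModule) (W := C_NormedModule) g Cinv x Hg).
  eexists; exact (filterdiff_Cinv (g x) Hx).
Qed.

Lemma Cdiff_at_fst (p : C2) : Cdiff_at (fun y : C2 => fst y) p.
Proof.
  apply ex_filterdiff_linear.
  exact (is_linear_fst (U := C_NormedModule) (V := C_NormedModule)).
Qed.

Lemma Cdiff_at_snd (p : C2) : Cdiff_at (fun y : C2 => snd y) p.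
Proof.
  apply ex_filterdiff_linear.
  exact (is_linear_snd (U := C_NormedModule) (V := C_NormedModule)).
Qed.

Lemma Cdiff_at_comp_fst (f : C -> C) (p : C2) :
  Cdiff_at (E := C_NormedModule) f (fst p) -> Cdiff_at (fun y : C2 => f (fst y)) p.
Proof.
  intros Hf.
  exact (ex_filterdiff_comp' (V := C_NormedModule) (W := C_NormedModule)
           (fun y : C2 => fst y) f p (Cdiff_at_fst p) Hf).
Qed.

(** * Exponential series and course-of-values recursion *)

(** Division by [n!] makes differentiation a mere index shift, so the equation and the initial
    conditions become relations between the [w n]. *)
Lemma fps_derivn_egf (w : nat -> C) (k n : nat) :
  fps_derivn k (fps_egf w) n = (w (n + k)%nat / RtoC (INR (fact n)))%C.
Proof.
  revert n; induction k as [|k IH]; intros n.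
  - now rewrite Nat.add_0_r.
  - change (RtoC (INR (n + 1)) * fps_derivn k (fps_egf w) (n + 1)%nat
            = w (n + S k)%nat / RtoC (INR (fact n)))%C.
    rewrite IH.
    replace (n + 1 + k)%nat with (n + S k)%nat by lia.
    rewrite Nat.add_1_r, fact_simpl, mult_INR, RtoC_mult.
    field. split; intros H; apply RtoC_inj in H.
    + now apply (INR_fact_neq_0 n).
    + now apply (not_0_INR (S n)).
Qed.

Section Recursion.

Context {A : Type} (a0 : A) (F : nat -> (nat -> A) -> A).

(** The argument [m] is fuel: when [F n] looks only below [n], the value at [n] is final once
    [m > n], and [a0] is a mere filler. *)
Fixpoint approx (m : nat) : nat -> A :=
  match m with
  | O => fun _ => a0
  | S m => fun n => F n (approx m)
  end.

Definition course_of_values (n : nat) : A := approx (S n) n.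

Lemma course_of_values_eq
  (HF : forall n v w, (forall i, (i < n)%nat -> v i = w i) -> F n v = F n w) (n : nat) :
  course_of_values n = F n course_of_values.
Proof.
  assert (stable : forall n m m', (n < m)%nat -> (n < m')%nat -> approx m n = approx m' n).
  { induction n0 as [n0 IH] using lt_wf_ind; intros [|m] [|m'] Hm Hm'; try lia.
    apply HF; intros i Hi; apply IH; lia. }
  apply HF; intros i Hi; apply stable; lia.
Qed.

End Recursion.

(** * Elementary inequalities and the majorant *)

(** The point is a bound that does not grow with [n]: a Cauchy product with a polynomial of degree
    at most [N] has at most [N + 1] nonzero terms. *)
Lemma Cmod_sum_n_le (f : nat -> C) (c : R) (n N : nat) :
  0 <= c ->
  (forall i, (i <= n)%nat -> Cmod (f i) <= c) ->
  (forall i, (i <= n)%nat -> (N < i)%nat -> f i = RtoC 0) ->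
  Cmod (sum_n f n) <= INR (S N) * c.
Proof.
  intros Hc Hf H0.
  enough (Cmod (sum_n f n) <= INR (S (Nat.min n N)) * c) as H.
  { apply (Rle_trans _ _ _ H), Rmult_le_compat_r; [exact Hc|]. apply le_INR; lia. }
  induction n as [|n IH].
  - rewrite sum_O; simpl Nat.min; simpl INR. rewrite Rmult_1_l. now apply Hf.
  - rewrite sum_Sn. change (Cmod (sum_n f n + f (S n)) <= INR (S (Nat.min (S n) N)) * c)%C.
    specialize (IH (fun i Hi => Hf i (le_S _ _ Hi)) (fun i Hi => H0 i (le_S _ _ Hi))).
    destruct (le_lt_dec (S n) N) as [Hn|Hn].
    + rewrite (Nat.min_l (S n)) by lia. rewrite Nat.min_l in IH by lia.
      eapply Rle_trans; [apply Cmod_triangle|].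
      rewrite (S_INR (S n)). specialize (Hf (S n) (le_n _)). lra.
    + rewrite (H0 (S n)) by lia. rewrite Cplus_0_r.
      rewrite Nat.min_r in * by lia. exact IH.
Qed.

(** Factor by factor, [(j+1)...(j+k) <= (n+1)...(n+k)]. *)
Lemma fact_mul_le (j n k : nat) : (j <= n)%nat ->
  (fact n * fact (j + k) <= fact j * fact (n + k))%nat.
Proof.
  intros Hj; induction k as [|k IH].
  - rewrite !Nat.add_0_r; lia.
  - rewrite !Nat.add_succ_r, !fact_simpl. nia.
Qed.

Lemma exp_le (a b : R) : a <= b -> exp a <= exp b.
Proof. intros [H| ->]; [left; now apply exp_increasing|right; reflexivity]. Qed.

(** Since [ln x0 <= 0], [t ln x >= t ln x0 >= T ln x0]; this treats [x < 1] and [x >= 1]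
    together. *)
Lemma Rpower_lower_bound (x0 x t T : R) :
  0 < x0 <= 1 -> x0 <= x -> 0 <= t <= T -> Rpower x0 T <= Rpower x t.
Proof.
  intros Hx0 Hx Ht. unfold Rpower.
  assert (ln x0 <= 0) by (rewrite <- ln_1; apply ln_le; lra).
  assert (ln x0 <= ln x) by (apply ln_le; lra).
  apply exp_le. nra.
Qed.

(** The claimed bound without its constant and without [exp (M ln^2 x)]. Both are independent of [n]
    and pass through the recursion as a common factor [K]. *)
Definition growth (Q x A1 Cc rho : R) (n : nat) : R :=
  INR (fact n) * rho ^ n * Rpower x (Cc * INR n) * Rpower Q (- A1 * INR n ^ 2).

Section Growth.

Context (Q x x0 A1 Cc rho : R) (hQ : 1 < Q) (hx0 : 0 < x0 <= 1) (hx : x0 <= x)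
  (hA1 : 0 < A1) (hCc : 0 < Cc) (hrho : 1 <= rho).

Lemma growth_ge_0 (n : nat) : 0 <= growth Q x A1 Cc rho n.
Proof.
  unfold growth. repeat apply Rmult_le_pos; try (left; apply exp_pos).
  - apply pos_INR.
  - apply pow_le; lra.
Qed.

(** Starts the induction: over the finitely many initial indices the majorant stays above a positive
    constant independent of [x] and [rho]. *)
Lemma growth_lower_bound (n N : nat) : (n <= N)%nat ->
  Rpower x0 (Cc * INR N) * Rpower Q (- A1 * INR N ^ 2) <= growth Q x A1 Cc rho n.
Proof.
  intros Hn. apply le_INR in Hn. pose proof (pos_INR n).
  apply Rmult_le_compat; try (left; apply exp_pos).
  - assert (1 <= INR (fact n)) by apply (le_INR 1), lt_O_fact.
    assert (1 <= rho ^ n) by now apply pow_R1_Rle.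
    assert (Rpower x0 (Cc * INR N) <= Rpower x (Cc * INR n))
      by (apply Rpower_lower_bound; [assumption..|split; nra]).
    rewrite <- (Rmult_1_l (Rpower x0 _)).
    apply Rmult_le_compat; [lra|left; apply exp_pos|nra|assumption].
  - assert (INR n ^ 2 <= INR N ^ 2) by (apply pow_incr; lra).
    apply Rle_Rpower; nra.
Qed.

(* With [h = S - k + i] and [N = n + S], the powers of [Q] match because
   [(N - h)^2 + 2 h (N - h - k) = N^2 - h^2 - 2 h k]. *)
Lemma growth_step (S H j k n i m0 m1 : nat) :
  (j + i = n)%nat -> (k < S)%nat -> (S - k + i <= H)%nat ->
  INR m0 <= Cc * (INR S - INR k + INR i) ->
  2 * (INR S - INR k + INR i) * A1 <= INR m1 ->
  INR (fact n) * (x ^ m0 * / (Q ^ m1) ^ j * (growth Q x A1 Cc rho (j + k) / INR (fact j)))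
    <= Rpower x0 (- (Cc * INR H)) * Rpower Q (A1 * (INR H ^ 2 + 2 * INR H * INR S)) / rho
       * growth Q x A1 Cc rho (n + S).
Proof.
  intros Hj Hk HH Hm0 Hm1.
  assert (Hh : 1 <= INR S - INR k + INR i <= INR H).
  { rewrite <- minus_INR, <- plus_INR by lia. split.
    - apply (le_INR 1); lia.
    - apply le_INR; lia. }
  set (h := INR S - INR k + INR i) in *.
  assert (Hn : INR (n + S) = INR (j + k) + h).
  { unfold h. rewrite !plus_INR, <- Hj, plus_INR. lra. }
  assert (Hx : 0 < x) by lra.
  pose proof (pos_INR j) as Hj0. pose proof (pos_INR k) as Hk0.
  assert (Hks : INR k <= INR S) by (apply le_INR; lia).
  (* The exponents of [x] on the two sides differ by [Cc * h - m0], which lies between 0 and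
     [Cc * H]; hence the surplus power of [x] is at least [x0 ^ (Cc * H)]. *)
  assert (E1 : x ^ m0 * Rpower x (Cc * INR (j + k))
               <= Rpower x0 (- (Cc * INR H)) * Rpower x (Cc * INR (n + S))).
  { rewrite <- Rpower_pow, <- Rpower_plus by exact Hx.
    replace (Cc * INR (n + S))
      with (INR m0 + Cc * INR (j + k) + (Cc * h - INR m0)) by (rewrite Hn; ring).
    rewrite (Rpower_plus (INR m0 + _)).
    rewrite Rpower_Ropp.
    pose proof (Rpower_lower_bound x0 x (Cc * h - INR m0) (Cc * INR H) hx0 hx) as B.
    assert (0 < Rpower x0 (Cc * INR H)) by apply exp_pos.
    assert (0 < Rpower x (INR m0 + Cc * INR (j + k))) by apply exp_pos.
    rewrite <- Rmult_assoc, (Rmult_comm (/ _)), Rmult_assoc.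
    rewrite <- (Rmult_1_r (Rpower x (INR m0 + _))) at 1.
    apply Rmult_le_compat_l; [lra|].
    rewrite Rmult_comm. apply Rle_div_r; [assumption|]. rewrite Rmult_1_l.
    apply B. pose proof (pos_INR m0). split; nra. }
  assert (E2 : / (Q ^ m1) ^ j * Rpower Q (- A1 * INR (j + k) ^ 2)
               <= Rpower Q (A1 * (INR H ^ 2 + 2 * INR H * INR S))
                  * Rpower Q (- A1 * INR (n + S) ^ 2)).
  { rewrite <- pow_mult, <- Rpower_pow, <- Rpower_Ropp, <- !Rpower_plus by lra.
    apply Rle_Rpower; [lra|].
    rewrite Hn, mult_INR, plus_INR.
    assert (2 * h * A1 * INR j <= INR m1 * INR j) by now apply Rmult_le_compat_r.
    assert (h * h <= INR H * INR H) by (apply Rmult_le_compat; lra).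
    assert (h * INR k <= INR H * INR S) by (apply Rmult_le_compat; lra).
    assert (A1 * (h * h + 2 * (h * INR k)) <= A1 * (INR H * INR H + 2 * (INR H * INR S)))
      by (apply Rmult_le_compat_l; lra).
    nra. }
  (* Since [k < S] and [j <= n], the index [j + k] is strictly below [n + S], which gains one full
     factor [/ rho]. *)
  assert (E3 : rho ^ (j + k) <= rho ^ (n + S) / rho).
  { apply Rle_div_r; [lra|]. rewrite Rmult_comm. change (rho ^ Datatypes.S (j + k) <= rho ^ (n + S)).
    apply Rle_pow; [exact hrho|lia]. }
  assert (E4 : INR (fact n) * INR (fact (j + k)) / INR (fact j) <= INR (fact (n + S))).
  { apply Rle_div_l; [apply INR_fact_lt_0|]. rewrite <- !mult_INR. apply le_INR.
    pose proof (fact_mul_le j n k ltac:(lia)).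
    pose proof (fact_le (n + k) (n + S) ltac:(lia)). nia. }
  unfold growth.
  assert (0 < x ^ m0) by now apply pow_lt.
  assert (0 < / (Q ^ m1) ^ j) by (apply Rinv_0_lt_compat; do 2 apply pow_lt; lra).
  assert (0 <= rho ^ (j + k)) by (apply pow_le; lra).
  pose proof (INR_fact_lt_0 n). pose proof (INR_fact_lt_0 j). pose proof (INR_fact_lt_0 (j + k)).
  apply Rle_trans with
    (INR (fact n) * INR (fact (j + k)) / INR (fact j) * rho ^ (j + k)
     * (x ^ m0 * Rpower x (Cc * INR (j + k)))
     * (/ (Q ^ m1) ^ j * Rpower Q (- A1 * INR (j + k) ^ 2))).
  { right; unfold Rdiv; ring. }
  apply Rle_trans with
    (INR (fact (n + S)) * (rho ^ (n + S) / rho)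
     * (Rpower x0 (- (Cc * INR H)) * Rpower x (Cc * INR (n + S)))
     * (Rpower Q (A1 * (INR H ^ 2 + 2 * INR H * INR S)) * Rpower Q (- A1 * INR (n + S) ^ 2))).
  2: { right; unfold Rdiv; ring. }
  assert (0 <= INR (fact n) * INR (fact (j + k)) / INR (fact j)).
  { apply Rlt_le, Rdiv_lt_0_compat; [now apply Rmult_lt_0_compat|assumption]. }
  assert (0 < Rpower x (Cc * INR (j + k))) by apply exp_pos.
  assert (0 < Rpower Q (- A1 * INR (j + k) ^ 2)) by apply exp_pos.
  apply Rmult_le_compat; [| |apply Rmult_le_compat; [| |now apply Rmult_le_compat|exact E1]|exact E2];
    repeat (lra || apply Rmult_le_pos).
Qed.

End Growth.

(** * Finite families of bounds, and moduli on the two spirals *)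

Lemma filter_forall_in {T A : Type} (F : (T -> Prop) -> Prop) {FF : Filter F}
  (l : list A) (P : A -> T -> Prop) :
  (forall a, In a l -> F (P a)) -> F (fun t => forall a, In a l -> P a t).
Proof.
  induction l as [|a l IH]; intros H.
  - apply filter_forall; intros t a [].
  - assert (H1 := H a (or_introl eq_refl)).
    assert (H2 := IH (fun c Hc => H c (or_intror Hc))).
    generalize (filter_and _ _ H1 H2). apply filter_imp.
    intros t [Ht1 Ht2] c [<-|Hc]; auto.
Qed.

Lemma discrete_spiral_Cmod_le (q : C) (U : C -> Prop) : 1 < Cmod q -> Cbounded U ->
  exists B, 0 < B /\ forall x, discrete_spiral q U x -> Cmod x <= B.
Proof.
  intros Hq [B HB]. exists (Rmax B 1). split; [apply Rlt_le_trans with 1; [lra|apply Rmax_r]|].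
  intros x (e & n & He & ->).
  assert (Hqn : 1 <= Cmod q ^ n) by (apply pow_R1_Rle; lra).
  rewrite Cmod_div, Cmod_pow by (apply Cpow_nz, Cmod_gt_0; lra).
  apply Rle_trans with (Cmod e); [|apply (Rle_trans _ _ _ (HB e He)), Rmax_l].
  apply Rle_div_l; [lra|]. pose proof (Cmod_ge_0 e). nra.
Qed.

Lemma discrete_spiral_neq_0 (q : C) (U : C -> Prop) (x : C) : 1 < Cmod q -> ~ U (RtoC 0) ->
  discrete_spiral q U x -> x <> RtoC 0.
Proof.
  intros Hq HU (e & n & He & ->) H.
  assert (Hqn : (q ^ n)%C <> RtoC 0) by (apply Cpow_nz, Cmod_gt_0; lra).
  apply HU. replace (RtoC 0) with e; [exact He|].
  replace e with (e / q ^ n * q ^ n)%C by (field; exact Hqn). rewrite H; ring.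
Qed.

Lemma Cmod_Cexp (z : C) : Cmod (Cexp z) = exp (Re z).
Proof.
  unfold Cexp, Cmod; cbn [fst snd].
  replace ((exp (Re z) * cos (Im z)) ^ 2 + (exp (Re z) * sin (Im z)) ^ 2)
    with (exp (Re z) ^ 2 * (Rsqr (sin (Im z)) + Rsqr (cos (Im z)))) by (unfold Rsqr; ring).
  rewrite sin2_cos2, Rmult_1_r. apply sqrt_pow2. left; apply exp_pos.
Qed.

(** [|q| = exp (Re logq) > 1] gives [Re logq > 0] for any determination of the logarithm, hence
    [|q^l| >= 1] for [l >= 0]. *)
Lemma continuous_spiral_Cmod_ge (q logq : C) (V : C -> Prop) (d : R) :
  1 < Cmod q -> Cexp logq = q -> 0 <= d -> (forall t, V t -> d <= Cmod t) ->
  forall x, continuous_spiral logq V x -> d <= Cmod x.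
Proof.
  intros Hq Hlog Hd HV x (t & l & Ht & Hl & ->).
  rewrite Cmod_mult. unfold qpow. rewrite Cmod_Cexp.
  assert (Hre : 0 < Re logq).
  { rewrite <- Hlog, Cmod_Cexp, <- exp_0 in Hq. now apply exp_lt_inv. }
  assert (1 <= exp (Re (RtoC l * logq)%C)).
  { rewrite <- exp_0. apply exp_le. destruct logq as [u v]; simpl in *. nra. }
  specialize (HV t Ht). nra.
Qed.

(** * The coefficients of the right-hand side of the equation *)

(** It acts on sequences of numbers at a fixed point [p = (eps, tau)], so that the recursion can be
    run pointwise and holomorphy recovered afterwards. *)
Definition rhs_coeff (q : C) (S : nat) (m0 m1 : nat -> nat) (J : nat -> list nat)
    (b : nat -> nat -> C -> C) (p : C2) (w : nat -> C) (n : nat) : C :=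
  sum_n (fun k =>
    fps_mul
      (fps_scal (snd p ^ m0 k / ((snd p + 1) * fst p ^ m0 k))%C
         (fps_poly (J k) (fun s => b k s (fst p))))
      (fps_dilate (/ q ^ m1 k)%C (fps_derivn k (fps_egf w))) n) (S - 1).

Section RhsCoeff.

Context (q : C) (S : nat) (m0 m1 : nat -> nat) (J : nat -> list nat)
  (b : nat -> nat -> C -> C) (hS : (1 <= S)%nat).

(** The entries reached have index [n - i + k] with [k <= S - 1], so at most [n + S - 1]; this makes
    the recursion for index [n + S] well-founded. *)
Lemma rhs_coeff_ext (p : C2) (v w : nat -> C) (n : nat) :
  (forall i, (i < n + S)%nat -> v i = w i) ->
  rhs_coeff q S m0 m1 J b p v n = rhs_coeff q S m0 m1 J b p w n.
Proof.
  intros H. apply sum_n_ext_loc; intros k Hk. apply sum_n_ext_loc; intros i Hi.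
  unfold fps_dilate. rewrite !fps_derivn_egf, H by lia. reflexivity.
Qed.

Lemma Cdiff_at_rhs_coeff (p : C2) (w : nat -> C2 -> C) (n : nat) :
  (fst p <> RtoC 0)%C -> (snd p + 1 <> RtoC 0)%C ->
  (forall k s, (k < S)%nat -> In s (J k) -> Cdiff_at (E := C_NormedModule) (b k s) (fst p)) ->
  (forall i, (i < n + S)%nat -> Cdiff_at (w i) p) ->
  Cdiff_at (fun y => rhs_coeff q S m0 m1 J b y (fun i => w i y) n) p.
Proof.
  intros H0 H1 Hb Hw.
  apply Cdiff_at_sum_n; intros k Hk. apply Cdiff_at_sum_n; intros i Hi.
  apply Cdiff_at_mult; [apply Cdiff_at_mult|apply Cdiff_at_mult].
  - apply Cdiff_at_div.
    + apply Cmult_neq_0; [exact H1|now apply Cpow_nz].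
    + apply Cdiff_at_pow, Cdiff_at_snd.
    + apply Cdiff_at_mult.
      * apply Cdiff_at_plus; [apply Cdiff_at_snd|apply Cdiff_at_const].
      * apply Cdiff_at_pow, Cdiff_at_fst.
  - unfold fps_poly. destruct (in_dec Nat.eq_dec i (J k)) as [Hi'|_].
    + apply Cdiff_at_comp_fst, Hb; [lia|exact Hi'].
    + apply Cdiff_at_const.
  - apply Cdiff_at_const.
  - apply Cdiff_at_ext with (fun y => w (n - i + k)%nat y * / RtoC (INR (fact (n - i))))%C.
    + intros y; now rewrite fps_derivn_egf.
    + apply Cdiff_at_mult; [apply Hw; lia|apply Cdiff_at_const].
Qed.

(** Summing over [k] costs [S], summing over [i] costs [N + 1], the quotient [b / (tau + 1)] costs
    [B / M1], and the rest is [growth_step] with [H = S + N]. Apart from [/ rho], the resulting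
    factor is independent of [n], [eps], [tau] and [rho]. *)
Lemma rhs_coeff_bound (A1 Cc M1 B x0 rho K : R) (N : nat) (eps tau : C) (w : nat -> C) (n : nat) :
  1 < Cmod q -> 0 < A1 -> 0 < Cc -> 0 < M1 -> 0 <= B -> 0 < x0 <= 1 -> 1 <= rho -> 0 <= K ->
  eps <> RtoC 0 -> M1 < Cmod (tau + 1)%C -> x0 <= Cmod (tau / eps)%C ->
  (forall k s, (k < S)%nat -> In s (J k) ->
     (s <= N)%nat /\ Cmod (b k s eps) <= B /\
     INR (m0 k) <= Cc * (INR S - INR k + INR s) /\
     2 * (INR S - INR k + INR s) * A1 <= INR (m1 k)) ->
  (forall i, (i < n + S)%nat ->
     Cmod (w i) <= K * growth (Cmod q) (Cmod (tau / eps)%C) A1 Cc rho i) ->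
  INR (fact n) * Cmod (rhs_coeff q S m0 m1 J b (eps, tau) w n) <=
    INR S * INR (Datatypes.S N) * (B / M1) * Rpower x0 (- (Cc * INR (S + N)))
    * Rpower (Cmod q) (A1 * (INR (S + N) ^ 2 + 2 * INR (S + N) * INR S)) / rho
    * (K * growth (Cmod q) (Cmod (tau / eps)%C) A1 Cc rho (n + S)).
Proof.
  intros hq hA1 hCc hM1 hB hx0 hrho hK heps htau hx hJ hw.
  set (x := Cmod (tau / eps)) in *.
  set (g := growth (Cmod q) x A1 Cc rho) in *.
  set (G := Rpower x0 _). set (G' := Rpower (Cmod q) _).
  assert (hg : forall i, 0 <= g i) by (intros i; apply growth_ge_0; lra).
  assert (hG : 0 < G) by apply exp_pos. assert (hG' : 0 < G') by apply exp_pos.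
  (* A common bound for all terms of the double sum; the division by [n!] offsets the factor [n!] of
     the conclusion. *)
  set (c := B / M1 * (G * G' / rho * (K * g (n + S)%nat)) / INR (fact n)).
  pose proof (INR_fact_lt_0 n) as hn.
  assert (hGr : 0 <= G * G' / rho) by (apply Rlt_le, Rdiv_lt_0_compat; nra).
  assert (hBM : 0 <= B / M1) by (apply Rdiv_le_0_compat; lra).
  assert (hc : 0 <= c).
  { apply Rdiv_le_0_compat; [|exact hn].
    apply Rmult_le_pos; [exact hBM|]. apply Rmult_le_pos; [exact hGr|].
    now apply Rmult_le_pos. }
  enough (Cmod (rhs_coeff q S m0 m1 J b (eps, tau) w n)
          <= INR (Datatypes.S (S - 1)) * (INR (Datatypes.S N) * c)) as H.
  { replace (Datatypes.S (S - 1)) with S in H by lia.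
    apply (Rmult_le_compat_l (INR (fact n))) in H; [|lra].
    apply (Rle_trans _ _ _ H). right. unfold c. field. lra. }
  apply Cmod_sum_n_le; [apply Rmult_le_pos; [apply pos_INR|exact hc]| |intros; lia].
  intros k Hk. apply Cmod_sum_n_le; [exact hc| |].
  2: { intros i _ Hi. unfold fps_scal, fps_poly.
       destruct (in_dec Nat.eq_dec i (J k)) as [Hi'|_]; [|ring].
       apply hJ in Hi'; lia. }
  intros i Hi. unfold fps_scal, fps_poly, fps_dilate; cbn [fst snd].
  destruct (in_dec Nat.eq_dec i (J k)) as [Hi'|_].
  2: { rewrite Cmult_0_r, Cmult_0_l, Cmod_0. exact hc. }
  destruct (hJ k i ltac:(lia) Hi') as (HiN & Hb & Hm0 & Hm1).
  rewrite fps_derivn_egf.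
  assert (Hq0 : q <> RtoC 0) by (apply Cmod_gt_0; lra).
  assert (Ht1 : (tau + 1)%C <> RtoC 0) by (apply Cmod_gt_0; lra).
  assert (He : (eps ^ m0 k)%C <> RtoC 0) by now apply Cpow_nz.
  (* Apart from [tau + 1], only the quotient [tau / eps] enters, whose modulus is the variable [x]
     of the majorant. *)
  replace (tau ^ m0 k / ((tau + 1) * eps ^ m0 k))%C
    with ((tau / eps) ^ m0 k / (tau + 1))%C.
  2: { unfold Cdiv. rewrite Cpow_mult_l, Cpow_inv by exact heps. field. now split. }
  assert (HF : RtoC (INR (fact (n - i))) <> RtoC 0).
  { intros E; apply RtoC_inj in E. now apply (INR_fact_neq_0 (n - i)). }
  rewrite !Cmod_mult, !Cmod_div, !Cmod_pow, Cmod_inv, Cmod_pow, Cmod_R by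
    first [assumption | now apply Cpow_nz].
  rewrite (Rabs_pos_eq (INR _)) by apply pos_INR.
  fold x.
  pose proof (growth_step (Cmod q) x x0 A1 Cc rho hq hx0 hx hA1 hCc hrho S (S + N)
    (n - i) k n i (m0 k) (m1 k) ltac:(lia) ltac:(lia) ltac:(lia) Hm0 Hm1) as H.
  fold G G' g in H.
  unfold c. refine (proj1 (Rle_div_r _ _ _ hn) _).
  assert (Hq1 : 0 < / (Cmod q ^ m1 k) ^ (n - i))
    by (apply Rinv_0_lt_compat; do 2 apply pow_lt; lra).
  assert (Hx1 : 0 < x ^ m0 k) by (apply pow_lt; lra).
  pose proof (INR_fact_lt_0 (n - i)) as hni.
  apply Rle_trans with
    (B / M1 * (K * (INR (fact n) * (x ^ m0 k * / (Cmod q ^ m1 k) ^ (n - i)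
       * (g (n - i + k)%nat / INR (fact (n - i))))))).
  2: { apply Rmult_le_compat_l; [exact hBM|].
       replace (G * G' / rho * (K * g (n + S)%nat))
         with (K * (G * G' / rho * g (n + S)%nat)) by (unfold Rdiv; ring).
       apply Rmult_le_compat_l; assumption. }
  rewrite pow_inv.
  apply Rle_trans with
    ((Cmod (b k i eps) / Cmod (tau + 1)) * (Cmod (w (n - i + k)%nat))
      * (INR (fact n) * (x ^ m0 k * / (Cmod q ^ m1 k) ^ (n - i) / INR (fact (n - i))))).
  { right; field. repeat split; try lra. do 2 apply pow_nonzero; lra. }
  apply Rle_trans with
    ((B / M1) * (K * g (n - i + k)%nat)
      * (INR (fact n) * (x ^ m0 k * / (Cmod q ^ m1 k) ^ (n - i) / INR (fact (n - i))))).
  2: { right; unfold Rdiv; ring. }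
  apply Rmult_le_compat_r.
  { apply Rmult_le_pos; [lra|]. apply Rdiv_le_0_compat; [nra|exact hni]. }
  apply Rmult_le_compat; [|apply Cmod_ge_0| |apply hw; lia].
  - apply Rdiv_le_0_compat; [apply Cmod_ge_0|lra].
  - apply Rmult_le_compat; [apply Cmod_ge_0| |exact Hb|].
    + left; apply Rinv_0_lt_compat; lra.
    + apply Rinv_le_contravar; lra.
Qed.

End RhsCoeff.

(** * Construction of the solution and choice of the constants *)

Theorem theorem1
  (M A1 Cc : R) (hM : 0 < M) (hA1 : 0 < A1) (hCc : 0 < Cc)
  (q logq : C) (hq : 1 < Cmod q) (hlogq : Cexp logq = q)
  (U V : C -> Prop)
  (hUo : open U) (hUb : Cbounded U) (hU0 : ~ U (RtoC 0))
  (hVo : open V) (hVb : Cbounded V) (hV0 : ~ V (RtoC 0))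
  (hV1 : exists M1 : R, 0 < M1 /\
     forall tau : C, continuous_spiral logq V tau -> M1 < Cmod (tau + 1)%C)
  (hVd : exists d : R, 0 < d /\ forall tau : C, V tau -> d <= Cmod tau)
  (S : nat) (hS : (1 <= S)%nat)
  (m0 m1 : nat -> nat)
  (hm0 : forall k : nat, (k < S)%nat -> (0 < m0 k)%nat)
  (hm1 : forall k : nat, (k < S)%nat -> (0 < m1 k)%nat)
  (r0 : R) (hr0 : 0 < r0)
  (hUr : forall x : C, Cclosure (discrete_spiral q U) x -> Cdisc r0 x)
  (J : nat -> list nat)
  (b : nat -> nat -> C -> C)
  (hb : forall k s : nat, (k < S)%nat -> In s (J k) ->
     holomorphic_on (E := C_NormedModule) (Cdisc r0) (b k s) /\
     (exists B : R, forall x : C, Cdisc r0 x -> Cmod (b k s x) <= B))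
  (Winit : nat -> C * C -> C)
  (hWinit : forall j : nat, (j < S)%nat ->
     holomorphic_on (E := C2)
       (Cprod (discrete_spiral q U) (continuous_spiral logq V)) (Winit j))
  (hm0C : forall k s : nat, (k < S)%nat -> In s (J k) ->
     INR (m0 k) <= Cc * (INR S - INR k + INR s))
  (hm1A : forall k s : nat, (k < S)%nat -> In s (J k) ->
     2 * (INR S - INR k + INR s) * A1 <= INR (m1 k))
  (hgrowth : exists Delta Mt : R, 0 < Delta /\ 0 < Mt < M /\
     forall j : nat, (j < S)%nat -> forall eps tau : C,
       discrete_spiral q U eps -> continuous_spiral logq V tau ->
       Cmod (Winit j (eps, tau))
         <= Delta * exp (Mt * (ln (Cmod (tau / eps)%C)) ^ 2)) :
  exists W : nat -> C * C -> C,
    (forall beta : nat,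
       holomorphic_on (E := C2)
         (Cprod (discrete_spiral q U) (continuous_spiral logq V)) (W beta)) /\
    (forall eps tau : C,
       discrete_spiral q U eps -> continuous_spiral logq V tau ->
       let Wz : fps := fps_egf (fun beta => W beta (eps, tau)) in
       (forall n : nat,
          fps_derivn S Wz n =
          sum_n (fun k =>
            fps_mul
              (fps_scal (tau ^ m0 k / ((tau + 1) * eps ^ m0 k))%C
                 (fps_poly (J k) (fun s => b k s eps)))
              (fps_dilate (/ q ^ m1 k)%C (fps_derivn k Wz)) n) (S - 1)) /\
       (forall j : nat, (j < S)%nat ->
          fps_eval0 (fps_derivn j Wz) = Winit j (eps, tau))) /\
    (exists K delta : R, 0 < K /\ 0 < delta < 1 /\
       forall (beta : nat) (eps tau : C),
         discrete_spiral q U eps -> continuous_spiral logq V tau ->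
         Cmod (W beta (eps, tau))
           <= K * INR (fact beta)
              * (Rpower (Cmod q) (2 * A1 * INR S) / delta) ^ beta
              * Rpower (Cmod (tau / eps)%C) (Cc * INR beta)
              * exp (M * (ln (Cmod (tau / eps)%C)) ^ 2)
              * Rpower (Cmod q) (- A1 * INR beta ^ 2)).
Proof.
  destruct hV1 as (M1 & hM1 & hV1').
  destruct hVd as (d & hd & hVd').
  destruct hgrowth as (Delta & Mt & hDelta & hMt & hgr).
  destruct (discrete_spiral_Cmod_le q U hq hUb) as (BU & hBU & hU).
  (* The coefficient of [z^n] in the [S]-th derivative is [W_(n+S) / n!], whence the factor
     [(n - S)!] at index [n]. *)
  set (step := fun (p : C2) (n : nat) (w : nat -> C) =>
    if lt_dec n S then Winit n p
    else (RtoC (INR (fact (n - S))) * rhs_coeff q S m0 m1 J b p w (n - S))%C).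
  set (W := fun (n : nat) (p : C2) => course_of_values (RtoC 0) (step p) n).
  assert (W_eq : forall n p, W n p = step p n (fun i => W i p)).
  { intros n p. apply (course_of_values_eq (RtoC 0) (step p)).
    clear n; intros n v w H. unfold step. destruct (lt_dec n S); [reflexivity|].
    f_equal. apply rhs_coeff_ext; [exact hS|]. intros i Hi; apply H; lia. }
  assert (W_lt : forall n p, (n < S)%nat -> W n p = Winit n p).
  { intros n p Hn. rewrite W_eq. unfold step. now destruct (lt_dec n S). }
  assert (W_add : forall n p, W (n + S)%nat p =
    (RtoC (INR (fact n)) * rhs_coeff q S m0 m1 J b p (fun i => W i p) n)%C).
  { intros n p. rewrite W_eq. unfold step. destruct (lt_dec (n + S) S); [lia|].
    now rewrite Nat.add_sub. }
  assert (disc : forall e, discrete_spiral q U e -> Cdisc r0 e).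
  { intros e He. apply hUr. intros r Hr. exists e. split; [exact He|].
    replace (e - e)%C with (RtoC 0) by ring. now rewrite Cmod_0. }
  exists W. split; [|split].
  - intros n. induction n as [n IH] using lt_wf_ind. intros p [He Ht].
    destruct (le_lt_dec S n) as [Hn|Hn].
    (* The recursion is run at every [p], inside the domain or not, so the identities [W_add] and
       [W_lt] are global equalities, as [Cdiff_at_ext] requires. *)
    + apply Cdiff_at_ext with
        (fun y => RtoC (INR (fact (n - S))) * rhs_coeff q S m0 m1 J b y (fun i => W i y) (n - S))%C.
      { intros y. rewrite <- W_add. f_equal; lia. }
      apply Cdiff_at_mult; [apply Cdiff_at_const|].
      apply Cdiff_at_rhs_coeff; [exact hS| | | |].
      * now apply discrete_spiral_neq_0 with q U.
      * apply Cmod_gt_0. specialize (hV1' _ Ht). lra.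
      * intros k s Hk Hs. apply (hb k s Hk Hs). now apply disc.
      * intros i Hi. apply IH; [lia|now split].
    + apply Cdiff_at_ext with (Winit n); [intros y; now rewrite W_lt|].
      apply (hWinit n Hn); now split.
  - intros eps tau He Ht Wz. split.
    + intros n. unfold Wz. rewrite fps_derivn_egf, W_add. unfold rhs_coeff; cbn [fst snd].
      field. intros E; apply RtoC_inj in E. now apply (INR_fact_neq_0 n).
    + intros j Hj. unfold fps_eval0, Wz. rewrite fps_derivn_egf.
      rewrite Nat.add_0_l, W_lt by exact Hj. simpl. field.
  (* A single [N] bounds all exponents [s] and all [|b k s|], by finiteness of the index sets. *)
  - assert (HN : exists N : nat, forall n, (N <= n)%nat -> forall k, In k (seq 0 S) ->
      forall s, In s (J k) -> (s <= n)%nat /\ forall y, Cdisc r0 y -> Cmod (b k s y) <= INR n).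
    { apply (filter_forall_in eventually). intros k Hk. apply in_seq in Hk.
      apply (filter_forall_in eventually). intros s Hs.
      destruct (hb k s ltac:(lia) Hs) as [_ [B HB]].
      destruct (nfloor_ex (Rmax B 0) (Rmax_r _ _)) as [N HN].
      exists (Nat.max s (Datatypes.S N)). intros n Hn. split; [lia|].
      intros y Hy. apply (Rle_trans _ _ _ (HB y Hy)), (Rle_trans _ _ _ (Rmax_l B 0)).
      apply Rle_trans with (INR (Datatypes.S N)); [rewrite S_INR; lra|apply le_INR; lia]. }
    destruct HN as [N HN]. specialize (HN N (le_n N)).
    (* On the domain [|tau| >= d] and [|eps| <= BU], so [|tau / eps| >= x0]; the cap at 1 serves
       [Rpower_lower_bound]. *)
    set (x0 := Rmin 1 (d / BU)).
    assert (hx0 : 0 < x0 <= 1).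
    { split; [apply Rmin_pos; [lra|now apply Rdiv_lt_0_compat]|apply Rmin_l]. }
    set (T := INR S * INR (Datatypes.S N) * (INR N / M1) * Rpower x0 (- (Cc * INR (S + N)))
      * Rpower (Cmod q) (A1 * (INR (S + N) ^ 2 + 2 * INR (S + N) * INR S))).
    assert (hT : 0 <= T).
    { repeat apply Rmult_le_pos; try apply pos_INR; left;
        first [apply exp_pos|now apply Rinv_0_lt_compat]. }
    (* With [T >= 0] this yields both [delta < 1] and [rho >= T + 2], hence [T / rho <= 1], which
       closes the induction. *)
    set (delta := / (T + 2)).
    assert (hdelta : 0 < delta < 1).
    { split; [apply Rinv_0_lt_compat; lra|].
      rewrite <- Rinv_1. apply Rinv_lt_contravar; lra. }
    set (rho := Rpower (Cmod q) (2 * A1 * INR S) / delta).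
    assert (hrho : T + 2 <= rho).
    { unfold rho, delta, Rdiv. rewrite Rinv_inv.
      assert (1 <= Rpower (Cmod q) (2 * A1 * INR S)).
      { rewrite <- (Rpower_O (Cmod q)) by lra.
        apply Rle_Rpower; [lra|]. pose proof (pos_INR S). nra. }
      nra. }
    (* The lower bound of the majorant over indices up to [S]; dividing [Delta] by it makes the
       estimate hold for the initial data. *)
    set (low := Rpower x0 (Cc * INR S) * Rpower (Cmod q) (- A1 * INR S ^ 2)).
    assert (hlow : 0 < low) by (apply Rmult_lt_0_compat; apply exp_pos).
    assert (hK : 0 < Delta / low) by now apply Rdiv_lt_0_compat.
    exists (Delta / low), delta. split; [exact hK|split; [exact hdelta|]].
    intros beta eps tau He Ht. fold rho.
    assert (heps : eps <> RtoC 0) by now apply discrete_spiral_neq_0 with q U.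
    assert (hx : x0 <= Cmod (tau / eps)).
    { apply (Rle_trans _ _ _ (Rmin_r _ _)). rewrite Cmod_div by exact heps.
      assert (0 < Cmod eps) by now apply Cmod_gt_0.
      assert (d <= Cmod tau)
        by (apply (continuous_spiral_Cmod_ge q logq V d); [..|exact Ht]; auto; lra).
      apply Rmult_le_compat; [lra|left; now apply Rinv_0_lt_compat|assumption|].
      apply Rinv_le_contravar; [assumption|now apply hU]. }
    set (E := exp (M * ln (Cmod (tau / eps)) ^ 2)).
    assert (hE : 0 < E) by apply exp_pos.
    (* At fixed [eps] and [tau], [Delta / low * E] does not depend on [beta] and acts as the
       constant [K] of [rhs_coeff_bound]. *)
    enough (Cmod (W beta (eps, tau))
            <= Delta / low * E * growth (Cmod q) (Cmod (tau / eps)) A1 Cc rho beta) as H.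
    { apply (Rle_trans _ _ _ H). right. unfold growth. ring. }
    induction beta as [n IH] using lt_wf_ind.
    destruct (le_lt_dec S n) as [Hn|Hn].
    + replace n with (n - S + S)%nat by lia.
      rewrite W_add, Cmod_mult, Cmod_R, Rabs_pos_eq by apply pos_INR.
      eapply Rle_trans.
      { apply (rhs_coeff_bound q S m0 m1 J b hS A1 Cc M1 (INR N) x0 rho (Delta / low * E) N);
          try assumption; try lra.
        - apply pos_INR.
        - apply Rmult_le_pos; lra.
        - now apply hV1'.
        - intros k s Hk Hs. destruct (HN k) with (s := s) as [H1 H2]; [apply in_seq; lia|exact Hs|].
          split; [exact H1|]. split; [now apply H2, disc|]. split; [now apply hm0C|now apply hm1A].
        - intros i Hi. apply IH; lia. }
      fold T.
      rewrite <- (Rmult_1_l (Delta / low * E * _)) at 2.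
      apply Rmult_le_compat_r.
      * apply Rmult_le_pos; [apply Rmult_le_pos; lra|]. apply growth_ge_0; lra.
      * apply Rle_div_l; lra.
    + rewrite W_lt by exact Hn.
      apply (Rle_trans _ _ _ (hgr n Hn eps tau He Ht)).
      apply Rle_trans with (Delta / low * E * low).
      * replace (Delta / low * E * low) with (Delta * E) by (field; lra).
        (* The squared logarithm is nonnegative, so [Mt] may be raised to [M]. *)
        apply Rmult_le_compat_l; [lra|]. apply exp_le, Rmult_le_compat_r; [apply pow2_ge_0|lra].
      * apply Rmult_le_compat_l; [apply Rmult_le_pos; lra|].
        apply growth_lower_bound; lra || lia.
Qed.
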